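(* Let $f\in\mathcal{F}^A_{c_1}(\mathbb{R}^n)$ and $g\in\mathcal{F}_{0}(\mathbb{R}^m)$ with $c_1>0$, and let $(x^k,z^k,\lambda^k)_{k=1}^N$ be generated by ADMM with step length $t>0$ from the starting points $\lambda^0\in\mathbb{R}^r$, $z^0\in\mathbb{R}^m$. If $t\leq c_1$ and $N\geq 4$, then $$D(\lambda^\star)-D(\lambda^N)\leq \frac{\|\lambda^0-\lambda^\star\|^2+t^2\left\|z^0-z^\star\right\|_B^2}{4Nt}.$$
   Context: Problem: $\min_{(x,z)\in\mathbb{R}^n\times\mathbb{R}^m} f(x)+g(z)$ subject to $Ax+Bz=b$, where $f:\mathbb{R}^n\to\mathbb{R}\cup\{\infty\}$ and $g:\mathbb{R}^m\to\mathbb{R}\cup\{\infty\}$ are closed proper convex functions, $0\neq A\in\mathbb{R}^{r\times n}$, $0\neq B\in\mathbb{R}^{r\times m}$, $b\in\mathbb{R}^r$. The dual objective is $D(\lambda)=\min_{(x,z)} f(x)+g(z)+\langle\lambda,Ax+Bz-b\rangle$ (value $-\infty$ if unbounded below). Standing assumptions: $(x^\star,z^\star)$ is an optimal solution of the problem with corresponding Lagrange multiplier $\lambda^\star$ (a maximizer of $D$); strong duality holds, i.e. $\max_{\lambda} D(\lambda)=\min_{Ax+Bz=b} f(x)+g(z)$; each subproblem of ADMM attains its minimum. ADMM with step length $t>0$ and starting points $\lambda^0,z^0$: for $k=1,\dots,N$, 1. $x^{k}\in\operatorname{argmin}_x f(x)+\langle\lambda^{k-1},Ax\rangle+\tfrac{t}{2}\|Ax+Bz^{k-1}-b\|^2$;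 2. $z^{k}\in\operatorname{argmin}_z g(z)+\langle\lambda^{k-1},Bz\rangle+\tfrac{t}{2}\|Ax^k+Bz-b\|^2$; 3. $\lambda^k=\lambda^{k-1}+t(Ax^k+Bz^k-b)$. Notation: $\|\cdot\|$ is the Euclidean norm; $\|x\|_A=\|Ax\|$ and $\|z\|_B=\|Bz\|$ are seminorms. $\mathcal{F}_0(\mathbb{R}^m)$ is the set of closed proper convex functions on $\mathbb{R}^m$. $\mathcal{F}^A_{c}(\mathbb{R}^n)$ is the set of closed proper functions $f$ on $\mathbb{R}^n$ that are $c$-strongly convex relative to $\|\cdot\|_A$, i.e. $f-\tfrac{c}{2}\|\cdot\|_A^2$ is convex. *)

(* Defs.v *)
From HB Require Import structures.
From mathcomp Require Import all_boot all_order all_algebra.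
From mathcomp Require Import all_classical all_reals all_analysis.

Set Implicit Arguments.
Unset Strict Implicit.
Unset Printing Implicit Defensive.

Import Order.TTheory GRing.Theory Num.Theory.
Import numFieldNormedType.Exports.

Local Open Scope classical_set_scope.
Local Open Scope ring_scope.

Section EuclideanSpace.
Context {R : realType}.

Definition dotv d (u v : 'cV[R]_d) : R := \sum_(i < d) u i 0 * v i 0.

(* The norm `|u| of the library on matrices is the sup norm. *)
Definition enorm d (u : 'cV[R]_d) : R := Num.sqrt (dotv u u).

Definition seminorm_mx r d (M : 'M[R]_(r, d)) (u : 'cV[R]_d) : R :=
  enorm (M *m u).

End EuclideanSpace.

Section ConvexFunctions.
Context {R : realType} {d : nat}.
Implicit Types h : 'cV[R]_d -> \bar R.

Definition epigraph h : set ('cV[R]_d * R^o) :=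
  [set p | (h p.1 <= p.2%:E)%E].

Definition proper h : Prop :=
  (forall x, h x != -oo%E) /\ (exists x, h x != +oo%E).

(* Convexity is read on the epigraph, so that no convention on the arithmetic
   of infinite values is involved. *)
Definition convex_efun h : Prop := convex_set (epigraph h).

Definition closed_efun h : Prop := closed (epigraph h).

Definition F0 h : Prop := [/\ closed_efun h, proper h & convex_efun h].

(* The class F_c^M of c-strongly convex functions relative to |M .|. *)
Definition Fstrong r (M : 'M[R]_(r, d)) (c : R) h : Prop :=
  [/\ closed_efun h, proper h
    & convex_efun (fun x => (h x - (c / 2 * seminorm_mx M x ^+ 2)%:E)%E)].

Definition is_argmin h (x : 'cV[R]_d) : Prop := forall y, (h x <= h y)%E.

End ConvexFunctions.

Section Problem.
Context {R : realType} {n m r : nat}.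
Variables (f : 'cV[R]_n -> \bar R) (g : 'cV[R]_m -> \bar R).
Variables (A : 'M[R]_(r, n)) (B : 'M[R]_(r, m)) (b : 'cV[R]_r).

Definition feasible : set ('cV[R]_n * 'cV[R]_m) :=
  [set p | A *m p.1 + B *m p.2 = b].

Definition objective (p : 'cV[R]_n * 'cV[R]_m) : \bar R := (f p.1 + g p.2)%E.

Definition lagrangian (l : 'cV[R]_r) (p : 'cV[R]_n * 'cV[R]_m) : \bar R :=
  (f p.1 + g p.2 + (dotv l (A *m p.1 + B *m p.2 - b))%:E)%E.

(* An infimum: it is the minimum whenever the latter is attained, and -oo when
   the Lagrangian is unbounded below. *)
Definition dual_objective (l : 'cV[R]_r) : \bar R :=
  ereal_inf (range (lagrangian l)).

Definition optimal_solution (x : 'cV[R]_n) (z : 'cV[R]_m) : Prop :=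
  feasible (x, z) /\
  forall p, feasible p -> (objective (x, z) <= objective p)%E.

Definition dual_maximizer (l : 'cV[R]_r) : Prop :=
  forall l', (dual_objective l' <= dual_objective l)%E.

Definition strong_duality : Prop :=
  ereal_sup (range dual_objective) = ereal_inf (objective @` feasible).

(* The iterates of index 1, ..., N; the value x 0 is irrelevant. *)
Definition admm (t : R) (N : nat) (l0 : 'cV[R]_r) (z0 : 'cV[R]_m)
    (x : nat -> 'cV[R]_n) (z : nat -> 'cV[R]_m) (l : nat -> 'cV[R]_r) : Prop :=
  [/\ l 0%N = l0, z 0%N = z0
    & forall k, (1 <= k <= N)%N ->
      [/\ is_argmin (fun u => (f u + (dotv (l k.-1) (A *m u))%:E
            + (t / 2 * enorm (A *m u + B *m z k.-1 - b) ^+ 2)%:E)%E) (x k),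
          is_argmin (fun v => (g v + (dotv (l k.-1) (B *m v))%:E
            + (t / 2 * enorm (A *m x k + B *m v - b) ^+ 2)%:E)%E) (z k)
        & l k = l k.-1 + t *: (A *m x k + B *m z k - b)]].

End Problem.

(* Main.v *)
Require Import Defs.
From mathcomp Require Import all_boot all_order all_algebra.
From mathcomp Require Import all_classical all_reals all_analysis.
From mathcomp Require Import ring lra.

(* ADMM is Douglas-Rachford splitting on the dual.  Put
     lam_k = (l_k - ls)/t,  s_k = -B(z_k - zs),  p_k = -A(x_k - xs),
     mid_k = lam_(k-1) - s_(k-1) - p_k.
   Then p_k is the gradient at mid_k of a convex function phi and s_k a
   subgradient at lam_k of a convex function psi, where
   (phi + psi)(v) = (D(ls) - D(ls + t v))/t; phi is 1-smooth because t <= c1.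
   Normalise phi and psi to vanish at 0.  With d_k = s_k - s_(k-1),
   Phi_k = phi(mid_k) and Psi_k = psi(lam_k), the potential
     V_k = 2k(Phi_k + Psi_k) + |lam_k|^2 + k^2 |p_k + s_k|^2
           + k(k-2) |d_k|^2 - 2k <p_k, d_k>
   satisfies V_4 <= |lam_0|^2 + |s_0|^2 and is nonincreasing for k >= 4, and
   completing the square |lam_N - N(p_N + s_N)|^2 bounds V_N below by 4N times
   Phi_N + Psi_N - <p_N, d_N> + |d_N|^2/2, which by the descent lemma for phi
   is at least (D(ls) - D(l_N))/t. *)

Import Order.TTheory GRing.Theory Num.Theory.
Import numFieldNormedType.Exports.
Local Open Scope ring_scope.

(** * Dot product identities *)

Lemma dotv_ge0 {R : realType} {d} (u : 'cV[R]_d) : 0 <= dotv u u.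
Proof. by apply: sumr_ge0 => i _; rewrite -expr2 sqr_ge0. Qed.

Lemma enorm_sqr {R : realType} {d} (u : 'cV[R]_d) : enorm u ^+ 2 = dotv u u.
Proof. by rewrite sqr_sqrtr // dotv_ge0. Qed.

(** The identities it is applied to equate sums over the same coordinates, so it suffices to check
    them coordinate by coordinate in the field. *)
Ltac dotv_sum :=
  rewrite /dotv ?mulr_sumr -?sumrN -?big_split /=;
  apply: eq_bigr => ? _; rewrite !mxE.
Ltac dotv_ring := dotv_sum; first [ring | by field].

(** * Strong convexity and first-order conditions at minimizers *)

(** Isolated from [Fstrong] so that modulus 0 covers plain convexity and both blocks of variables
    share one argument. *)
Definition strongly_convex {R : realType} {d r} (M : 'M[R]_(r, d)) (c : R)
    (h : 'cV[R]_d -> \bar R) : Prop :=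
  convex_efun (fun x => (h x - (c / 2 * seminorm_mx M x ^+ 2)%:E)%E).

Lemma strongly_convex0 {R : realType} {d r} (M : 'M[R]_(r, d))
    {h : 'cV[R]_d -> \bar R} : convex_efun h -> strongly_convex M 0 h.
Proof.
rewrite /strongly_convex.
suff -> : (fun x => h x - (0 / 2 * seminorm_mx M x ^+ 2)%:E)%E = h by [].
by apply/funext => x; rewrite !mul0r sube0.
Qed.

(** At a point of the segment, [c/2 |M v|^2] falls short of its chord by exactly
    [c/2 th (1 - th) |M (y - u)|^2]; adding the quadratic back to the convex difference produces
    this term. *)
Lemma strongly_convex_segment {R : realType} {d r} {M : 'M[R]_(r, d)} {c : R}
    {h : 'cV[R]_d -> \bar R} (h_cvx : strongly_convex M c h)
    (u y : 'cV[R]_d) (hu hy th : R) :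
    h u = hu%:E -> h y = hy%:E -> 0 < th < 1 ->
  (h (u + th *: (y - u))%R <=
     (hu + th * (hy - hu)
      - c / 2 * (th * (1 - th)) * dotv (M *m (y - u)) (M *m (y - u)))%:E)%E.
Proof.
move=> huE hyE /andP[th0 th1].
pose e v : R := c / 2 * seminorm_mx M v ^+ 2.
have in_epi v a : h v = a%:E ->
    (v, a - e v : R^o) \in epigraph (fun x => (h x - (e x)%:E)%E).
  by move=> va; rewrite inE /epigraph /= va -EFinB.
have := h_cvx (y, hy - e y : R^o) (u, hu - e u : R^o)
  (Itv01 (ltW th0) (ltW th1)) (in_epi _ _ hyE) (in_epi _ _ huE).
rewrite inE /epigraph /= /conv /= /unstable.onem.
have -> : th *: y + (1 - th) *: u = u + th *: (y - u).
  by apply/matrixP => i j; rewrite !mxE; ring.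
set v := u + th *: (y - u).
have eE : e v = c / 2 * (dotv (M *m u) (M *m u)
    + 2 * th * dotv (M *m u) (M *m (y - u))
    + th ^+ 2 * dotv (M *m (y - u)) (M *m (y - u))).
  rewrite /e /seminorm_mx enorm_sqr /v mulmxDr -scalemxAr; congr (_ * _).
  by dotv_ring.
have eyE : e y = c / 2 * (dotv (M *m u) (M *m u)
    + 2 * dotv (M *m u) (M *m (y - u))
    + dotv (M *m (y - u)) (M *m (y - u))).
  rewrite /e /seminorm_mx enorm_sqr mulmxBr; congr (_ * _).
  by dotv_ring.
have euE : e u = c / 2 * dotv (M *m u) (M *m u).
  by rewrite /e /seminorm_mx enorm_sqr.
rewrite EFinN leeBlDr // -EFinD => /le_trans; apply; rewrite lee_fin.
rewrite -/(e v) eE eyE euE /GRing.scale /=.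
set X := dotv _ _; set Y := dotv _ _; set Z := dotv _ _.
rewrite le_eqVlt; apply/orP; left; apply/eqP; ring.
Qed.

(** Minimality is tested at [u + th (y - u)] and divided by [th]; as [th] tends to 0 the curvature
    [q] of [k] drops out, while the modulus [c] of [h] survives. *)
Lemma argmin_strong_subgradient {R : realType} {d r} {M : 'M[R]_(r, d)} {c : R}
    {h : 'cV[R]_d -> \bar R} {k : 'cV[R]_d -> R} {u : 'cV[R]_d}
    (w : 'cV[R]_r) (q : R) :
    strongly_convex M c h ->
    (forall y, (h u + (k u)%:E <= h y + (k y)%:E)%E) ->
    (forall y, k y = k u + dotv w (M *m (y - u))
                     + q * dotv (M *m (y - u)) (M *m (y - u))) ->
  forall y hu hy, h u = hu%:E -> h y = hy%:E ->
    hu - dotv w (M *m (y - u)) + c / 2 * dotv (M *m (y - u)) (M *m (y - u))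
    <= hy.
Proof.
move=> h_cvx u_min kE y hu hy huE hyE.
pose D := dotv (M *m (y - u)) (M *m (y - u)).
pose W := dotv w (M *m (y - u)).
have ineq th : 0 < th < 1 ->
    0 <= (hy - hu + W - c / 2 * D) + th * ((c / 2 + q) * D).
  move=> /[dup] th01 /andP[th0 th1].
  have := strongly_convex_segment h_cvx _ _ _ _ _ huE hyE th01.
  have := u_min (u + th *: (y - u)); rewrite huE -EFinD (kE (u + _)).
  rewrite [u + _]addrC addrK -scalemxAr.
  have -> : dotv w (th *: (M *m (y - u))) = th * W by dotv_ring.
  have -> : dotv (th *: (M *m (y - u))) (th *: (M *m (y - u))) = th ^+ 2 * D.
    by dotv_ring.
  case: (h _) => [v| |] //; rewrite -?EFinD !lee_fin -/D => H1 H2.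
  rewrite -(pmulr_rge0 _ th0); lra.
rewrite -/D -/W; set X := hy - hu + W - c / 2 * D in ineq.
suff : 0 <= X by rewrite /X; lra.
set Y := (c / 2 + q) * D in ineq; rewrite leNgt; apply/negP => X0.
have Y0 := normr_ge0 Y; have YY := ler_norm Y.
have P : 0 < `|Y| - X by lra.
(* One explicit [th] replaces the limit: it gives [X + th |Y| = X/2 + th X], negative when
   [X < 0]. *)
pose th := - X / (2 * (`|Y| - X)).
have thE : th * (2 * (`|Y| - X)) = - X by rewrite /th mulfVK // gt_eqF //; lra.
have th01 : 0 < th < 1.
  by rewrite /th divr_gt0 ?ltr_pdivrMr ?mul1r /=; lra.
have := ineq _ th01; case/andP: th01 => th0 _.
have : th * Y <= th * `|Y| by rewrite ler_wpM2l // ltW.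
nra.
Qed.

(** * Consequences of strong duality and finiteness of values *)

(** With feasibility, this equality says that [(xs, zs)] minimizes the Lagrangian at [ls]. *)
Lemma dual_optimum {R : realType} {n m r : nat}
    {f : 'cV[R]_n -> \bar R} {g : 'cV[R]_m -> \bar R}
    {A : 'M[R]_(r, n)} {B : 'M[R]_(r, m)} {b : 'cV[R]_r}
    {xs : 'cV[R]_n} {zs : 'cV[R]_m} {ls : 'cV[R]_r} :
    optimal_solution f g A B b xs zs -> dual_maximizer f g A B b ls ->
    strong_duality f g A B b ->
  dual_objective f g A B b ls = (f xs + g zs)%E.
Proof.
move=> [feas opt] max sd.
have -> : dual_objective f g A B b ls
    = ereal_sup (range (dual_objective f g A B b)).
  apply/eqP; rewrite eq_le; apply/andP; split.
    by apply: ereal_sup_ubound; exists ls.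
  by apply: ge_ereal_sup => _ [l' _ <-]; exact: max.
rewrite sd; apply/eqP; rewrite eq_le; apply/andP; split.
  by apply: ereal_inf_lbound; exists (xs, zs).
by apply: le_ereal_inf_tmp => _ [p pf <-]; exact: opt.
Qed.

Lemma dual_objective_le {R : realType} {n m r : nat}
    (f : 'cV[R]_n -> \bar R) (g : 'cV[R]_m -> \bar R)
    (A : 'M[R]_(r, n)) (B : 'M[R]_(r, m)) (b : 'cV[R]_r) l x z :
  (dual_objective f g A B b l <=
    f x + g z + (dotv l (A *m x + B *m z - b))%:E)%E.
Proof. by apply: ereal_inf_lbound; exists (x, z). Qed.

Lemma proper_fin {R : realType} {d} {h : 'cV[R]_d -> \bar R} :
  Defs.proper h -> exists y c, h y = c%:E.
Proof.
case=> hNy [y hy]; exists y; have := hNy y.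
by case: (h y) hy => [c| |] //; exists c.
Qed.

Lemma argmin_fin_num {R : realType} {d} {h : 'cV[R]_d -> \bar R}
    {k1 k2 : 'cV[R]_d -> R} {u : 'cV[R]_d} :
    Defs.proper h -> is_argmin (fun v => h v + (k1 v)%:E + (k2 v)%:E)%E u ->
  h u = (fine (h u))%:E.
Proof.
move=> h_proper u_min; have [y [c hy]] := proper_fin h_proper.
have := u_min y; rewrite hy; have := h_proper.1 u.
by case: (h u).
Qed.

(** * First-order conditions of the ADMM subproblems *)

(** In an ADMM step [z] is still the previous iterate, so the multiplier that appears is an
    intermediate one ([nu] further on), not the next [l]. *)
Lemma admm_x_subgradient {R : realType} {n m r : nat}
    {f : 'cV[R]_n -> \bar R} {A : 'M[R]_(r, n)} {B : 'M[R]_(r, m)}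
    {b : 'cV[R]_r} {c t : R} {l : 'cV[R]_r} {z : 'cV[R]_m} {x : 'cV[R]_n} :
    strongly_convex A c f ->
    is_argmin (fun u => (f u + (dotv l (A *m u))%:E
      + (t / 2 * enorm (A *m u + B *m z - b) ^+ 2)%:E)%E) x ->
  forall y fx fy, f x = fx%:E -> f y = fy%:E ->
    fx - dotv (l + t *: (A *m x + B *m z - b)) (A *m (y - x))
      + c / 2 * dotv (A *m (y - x)) (A *m (y - x)) <= fy.
Proof.
move=> f_cvx x_min.
apply: (argmin_strong_subgradient (k := fun u => dotv l (A *m u)
  + t / 2 * enorm (A *m u + B *m z - b) ^+ 2) _ (t / 2) f_cvx) => y.
  by have := x_min y; rewrite -!addeA -!EFinD.
rewrite !enorm_sqr mulmxBr; move: (A *m x) (A *m y) (B *m z) => u v w.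
by dotv_ring.
Qed.

(** The previous lemma with the blocks exchanged and modulus 0. Here [x] is already updated, so the
    multiplier is the next [l] itself. *)
Lemma admm_z_subgradient {R : realType} {n m r : nat}
    {g : 'cV[R]_m -> \bar R} {A : 'M[R]_(r, n)} {B : 'M[R]_(r, m)}
    {b : 'cV[R]_r} {t : R} {l : 'cV[R]_r} {z : 'cV[R]_m} {x : 'cV[R]_n} :
    convex_efun g ->
    is_argmin (fun v => (g v + (dotv l (B *m v))%:E
      + (t / 2 * enorm (A *m x + B *m v - b) ^+ 2)%:E)%E) z ->
  forall y gz gy, g z = gz%:E -> g y = gy%:E ->
    gz - dotv (l + t *: (A *m x + B *m z - b)) (B *m (y - z)) <= gy.
Proof.
move=> g_cvx z_min y gz gy gzE gyE.
have z_min' : is_argmin (fun v => (g v + (dotv l (B *m v))%:E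
    + (t / 2 * enorm (B *m v + A *m x - b) ^+ 2)%:E)%E) z.
  by move=> v; rewrite ![B *m _ + _]addrC; exact: z_min.
have := admm_x_subgradient (strongly_convex0 B g_cvx) z_min' y gz gy gzE gyE.
by rewrite mul0r mul0r addr0 [B *m z + _]addrC.
Qed.

(** * Potential argument for the abstract dual iteration *)

(** For ADMM this is [(nu_k - ls)/t], the rescaled intermediate multiplier. *)
Definition dual_mid {R : realType} {r} (lam s p : nat -> 'cV[R]_r) (k : nat) :=
  lam k.-1 - s k.-1 - p k.

(** [phi] and [psi] enter only through inequalities between finitely many points. [Phi_cvx] is the
    interpolation inequality of 1-smooth convex functions, and [Phi_opt] is the same against the
    origin, where value and gradient vanish; the [Psi] fields are the subgradient analogues. Indices
    start at 1 because [s 0] comes from an arbitrary starting point and need not be a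
    subgradient. *)
Record dual_run {R : realType} {r} (N : nat) (lam s p : nat -> 'cV[R]_r)
    (Phi Psi : nat -> R) : Prop := {
  dual_runE : forall k, (k < N)%N -> lam k.+1 = lam k - p k.+1 - s k.+1;
  Phi_cvx : forall i j, (0 < i <= N)%N -> (0 < j <= N)%N ->
    Phi j + dotv (p j) (dual_mid lam s p i - dual_mid lam s p j)
      + dotv (p i - p j) (p i - p j) / 2 <= Phi i;
  Phi_opt : forall k, (0 < k <= N)%N ->
    Phi k + dotv (p k) (p k) / 2 <= dotv (p k) (dual_mid lam s p k);
  Psi_cvx : forall i j, (0 < i <= N)%N -> (0 < j <= N)%N ->
    Psi j + dotv (s j) (lam i - lam j) <= Psi i;
  Psi_opt : forall k, (0 < k <= N)%N -> Psi k <= dotv (s k) (lam k) }.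

Arguments dual_runE {R r N lam s p Phi Psi} _ {k}.
Arguments Phi_cvx {R r N lam s p Phi Psi} _ {i j}.
Arguments Phi_opt {R r N lam s p Phi Psi} _ {k}.
Arguments Psi_cvx {R r N lam s p Phi Psi} _ {i j}.
Arguments Psi_opt {R r N lam s p Phi Psi} _ {k}.

Definition dual_potential {R : realType} {r} (lam s p : nat -> 'cV[R]_r)
    (Phi Psi : nat -> R) (k : nat) : R :=
  2 * k%:R * (Phi k + Psi k) + dotv (lam k) (lam k)
    + k%:R ^+ 2 * dotv (p k + s k) (p k + s k)
    + k%:R * (k%:R - 2) * dotv (s k - s k.-1) (s k - s k.-1)
    - 2 * k%:R * dotv (p k) (s k - s k.-1).

(** The one-step decrease rests on a quadratic form that is indefinite at [K = 3], so the first four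
    steps are bounded together. *)
Lemma dual_potential4_le {R : realType} {r N} {lam s p : nat -> 'cV[R]_r}
    {Phi Psi : nat -> R} (run : dual_run N lam s p Phi Psi) :
    (4 <= N)%N ->
  dual_potential lam s p Phi Psi 4
  <= dotv (lam 0) (lam 0) + dotv (s 0) (s 0).
Proof.
move=> N4; pose mid := dual_mid lam s p.
have N1 : (0 < 1 <= N)%N by exact: leq_trans N4.
have N2 : (0 < 2 <= N)%N by exact: leq_trans N4.
have N3 : (0 < 3 <= N)%N by exact: leq_trans N4.
have N4' : (0 < 4 <= N)%N by [].
have f14 := Phi_cvx run N1 N4'; have f24 := Phi_cvx run N2 N4'.
have f34 := Phi_cvx run N3 N4'; have f42 := Phi_cvx run N4' N2.
have f43 := Phi_cvx run N4' N3.
have g12 := Psi_cvx run N1 N2; have g21 := Psi_cvx run N2 N1.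
have g23 := Psi_cvx run N2 N3; have g32 := Psi_cvx run N3 N2.
have g34 := Psi_cvx run N3 N4'; have g43 := Psi_cvx run N4' N3.
have a1 := Phi_opt run N1; have a2 := Phi_opt run N2.
have a3 := Phi_opt run N3; have a4 := Phi_opt run N4'.
have b1 := Psi_opt run N1; have b2 := Psi_opt run N2.
have b3 := Psi_opt run N3; have b4 := Psi_opt run N4'.
(* The multipliers and the sum of squares below were found by solving the
   semidefinite program of worst-case performance estimation. *)
have q1 := dotv_ge0 (s 0 + p 1 - p 4).
have q2 := dotv_ge0 (s 2 - s 1 - p 2 + p 4).
have q3 := dotv_ge0 (2 *: (s 3 - s 2) - p 2 + p 4).
have q4 := dotv_ge0 (s 4 - s 3).
have q5 := dotv_ge0 (p 1).
have q6 := dotv_ge0 (p 2).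
have q7 := dotv_ge0 (p 3).
have q8 := dotv_ge0 (p 2 - p 3).
have q9 := dotv_ge0 (p 3 - p 4).
have q10 := dotv_ge0 (p 2 - p 4).
suff H : dotv (lam 0) (lam 0) + dotv (s 0) (s 0)
  - dotv (lam 4) (lam 4) - 16 * dotv (p 4 + s 4) (p 4 + s 4)
    - 8 * dotv (s 4 - s 3) (s 4 - s 3) + 8 * dotv (p 4) (s 4 - s 3)
  = 2 * dotv (p 1) (mid 1) + 2 * dotv (p 2) (mid 2)
    + 2 * dotv (p 3) (mid 3) + 2 * dotv (p 4) (mid 4)
    + 2 * dotv (s 1) (lam 1) + 2 * dotv (s 2) (lam 2)
    + 2 * dotv (s 3) (lam 3) + 2 * dotv (s 4) (lam 4)
    + (-1) * dotv (p 1) (p 1) + (-1) * dotv (p 2) (p 2)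
    + (-1) * dotv (p 3) (p 3) + (-1) * dotv (p 4) (p 4)
    + (-2) * dotv (p 4) (mid 1 - mid 4) + (-1) * dotv (p 1 - p 4) (p 1 - p 4)
    + (-4) * dotv (p 4) (mid 2 - mid 4) + (-2) * dotv (p 2 - p 4) (p 2 - p 4)
    + (-8) * dotv (p 4) (mid 3 - mid 4) + (-4) * dotv (p 3 - p 4) (p 3 - p 4)
    + (-2) * dotv (p 2) (mid 4 - mid 2) + (-1) * dotv (p 4 - p 2) (p 4 - p 2)
    + (-6) * dotv (p 3) (mid 4 - mid 3) + (-3) * dotv (p 4 - p 3) (p 4 - p 3)
    + (-4) * dotv (s 2) (lam 1 - lam 2) + (-2) * dotv (s 1) (lam 2 - lam 1)
    + (-12) * dotv (s 3) (lam 2 - lam 3) + (-8) * dotv (s 2) (lam 3 - lam 2)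
    + (-24) * dotv (s 4) (lam 3 - lam 4) + (-18) * dotv (s 3) (lam 4 - lam 3)
    + dotv (s 0 + p 1 - p 4) (s 0 + p 1 - p 4)
    + dotv (s 2 - s 1 - p 2 + p 4) (s 2 - s 1 - p 2 + p 4)
    + dotv (2 *: (s 3 - s 2) - p 2 + p 4) (2 *: (s 3 - s 2) - p 2 + p 4)
    + dotv (s 4 - s 3) (s 4 - s 3)
    + 2 * dotv (p 1) (p 1) + dotv (p 2) (p 2) + dotv (p 3) (p 3)
    + dotv (p 2 - p 3) (p 2 - p 3) + 7 * dotv (p 3 - p 4) (p 3 - p 4)
    + dotv (p 2 - p 4) (p 2 - p 4).
  (* In the weighted sum of the inequalities, [Phi] and [Psi] cancel at indices 1, 2, 3 and keep
     weight 8 at index 4, as in the potential. *)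
  rewrite /dual_potential /=; lra.
rewrite /mid /dual_mid /= !(dual_runE run) //; try exact: leq_trans N4.
dotv_ring.
Qed.

Lemma dual_potential_decr {R : realType} {r N} {lam s p : nat -> 'cV[R]_r}
    {Phi Psi : nat -> R} (run : dual_run N lam s p Phi Psi) k :
    (4 <= k < N)%N ->
  dual_potential lam s p Phi Psi k.+1 <= dual_potential lam s p Phi Psi k.
Proof.
pose mid := dual_mid lam s p; case: k => [|k]; first by rewrite ltn0.
move=> kN; have /andP[k4 ltkN] := kN.
have k0N : (0 < k.+1 <= N)%N by rewrite (ltnW ltkN).
have k1N : (0 < k.+2 <= N)%N by [].
have f1 := Phi_cvx run k0N k1N.
have f2 := Phi_cvx run k1N k0N.
have f3 := Phi_opt run k1N.
have g1 := Psi_cvx run k0N k1N.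
have g2 := Psi_cvx run k1N k0N.
have g3 := Psi_opt run k1N.
rewrite /dual_potential.
have K4 : 4 <= k.+1%:R :> R by rewrite ler_nat.
have -> : k.+2%:R = k.+1%:R + 1 :> R by rewrite -natr1.
move: K4; set K := k.+1%:R => K4.
(* With weight 2 on [f3] and [g3], these weights leave [2 (K + 1)] on the new values and [- 2 K] on
   the old ones, as the difference of potentials requires. *)
have Kf1 : (2 * K + 2 * K ^+ 2) *
    (Phi k.+2 + dotv (p k.+2) (mid k.+1 - mid k.+2)
     + dotv (p k.+1 - p k.+2) (p k.+1 - p k.+2) / 2)
    <= (2 * K + 2 * K ^+ 2) * Phi k.+1.
  by apply: ler_wpM2l f1; nra.
have Kf2 : (2 * K ^+ 2) *
    (Phi k.+1 + dotv (p k.+1) (mid k.+2 - mid k.+1)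
     + dotv (p k.+2 - p k.+1) (p k.+2 - p k.+1) / 2)
    <= (2 * K ^+ 2) * Phi k.+2.
  by apply: ler_wpM2l f2; nra.
have Kg1 : (2 * K + 2 * K ^+ 2) *
    (Psi k.+2 + dotv (s k.+2) (lam k.+1 - lam k.+2))
    <= (2 * K + 2 * K ^+ 2) * Psi k.+1.
  by apply: ler_wpM2l g1; nra.
have Kg2 : (2 * K ^+ 2) * (Psi k.+1 + dotv (s k.+1) (lam k.+2 - lam k.+1))
    <= (2 * K ^+ 2) * Psi k.+2.
  by apply: ler_wpM2l g2; nra.
pose d := s k.+1 - s k; pose e := p k.+2 - p k.+1.
(* This quadratic form in d, e has determinant
   K^2((K-2)(3K+1) - (K+1)^2) = K^2(2K^2 - 7K - 3), positive from K = 4 on. *)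
have block : 0 <= K * (K - 2) * dotv d d + 2 * (K ^+ 2 + K) * dotv d e
      + (3 * K ^+ 2 + K) * dotv e e.
  have Ke := dotv_ge0 e; have Kd := dotv_ge0 ((K - 2) *: d + (K + 1) *: e).
  have K2 : 0 < K - 2 by lra.
  have E : (K - 2) * (K * (K - 2) * dotv d d + 2 * (K ^+ 2 + K) * dotv d e
      + (3 * K ^+ 2 + K) * dotv e e) =
      K * dotv ((K - 2) *: d + (K + 1) *: e) ((K - 2) *: d + (K + 1) *: e)
      + K * (2 * K ^+ 2 - 7 * K - 3) * dotv e e.
    by rewrite !(mulrDr (K - 2)); dotv_ring.
  rewrite -(pmulr_rge0 _ K2) E.
  by apply: addr_ge0; apply: mulr_ge0 => //; nra.
have q1 := dotv_ge0 (p k.+2); have q2 := dotv_ge0 (s k.+2 - s k.+1).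
(* The potential drops by at least the form in [block], plus [|s_(K+1) - s_K|^2], plus the term
   [|p_(K+1)|^2] left over from [f3]. *)
suff H : dotv (lam k.+1) (lam k.+1)
    + K ^+ 2 * dotv (p k.+1 + s k.+1) (p k.+1 + s k.+1)
    + K * (K - 2) * dotv (s k.+1 - s k) (s k.+1 - s k)
    - 2 * K * dotv (p k.+1) (s k.+1 - s k)
    - dotv (lam k.+2) (lam k.+2)
    - (K + 1) ^+ 2 * dotv (p k.+2 + s k.+2) (p k.+2 + s k.+2)
    - (K + 1) * (K + 1 - 2) * dotv (s k.+2 - s k.+1) (s k.+2 - s k.+1)
    + 2 * (K + 1) * dotv (p k.+2) (s k.+2 - s k.+1)
  = 2 * dotv (p k.+2) (mid k.+2) + 2 * dotv (s k.+2) (lam k.+2)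
    - (2 * K + 2 * K ^+ 2) * dotv (p k.+2) (mid k.+1 - mid k.+2)
    - (K + K ^+ 2) * dotv (p k.+1 - p k.+2) (p k.+1 - p k.+2)
    - 2 * K ^+ 2 * dotv (p k.+1) (mid k.+2 - mid k.+1)
    - K ^+ 2 * dotv (p k.+2 - p k.+1) (p k.+2 - p k.+1)
    - (2 * K + 2 * K ^+ 2) * dotv (s k.+2) (lam k.+1 - lam k.+2)
    - 2 * K ^+ 2 * dotv (s k.+1) (lam k.+2 - lam k.+1)
    + K * (K - 2) * dotv d d + 2 * (K ^+ 2 + K) * dotv d e
    + (3 * K ^+ 2 + K) * dotv e e
    + dotv (s k.+2 - s k.+1) (s k.+2 - s k.+1).
  rewrite /=; lra.
rewrite /d /e /mid /dual_mid /= (dual_runE run ltkN).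
rewrite (dual_runE run (ltnW ltkN)).
dotv_ring.
Qed.

(** Since [dual_mid] at [N] is [lam N + d], the cross term of the completed square is bounded below
    by [Phi_opt] and [Psi_opt]. This doubles the weight of [Phi N + Psi N - <p N, d>] from [2N] to
    [4N]. *)
Lemma dual_potential_ge {R : realType} {r N} {lam s p : nat -> 'cV[R]_r}
    {Phi Psi : nat -> R} (run : dual_run N lam s p Phi Psi) (N4 : (4 <= N)%N)
    (d := s N - s N.-1) :
  4 * N%:R * (Phi N + Psi N - dotv (p N) d + dotv d d / 2) <=
  dual_potential lam s p Phi Psi N.
Proof.
have N0 : (0 < N <= N)%N by rewrite leqnn andbT (ltn_trans _ N4).
have f1 := Phi_opt run N0.
have g1 := Psi_opt run N0.
have M4 : 4 <= N%:R :> R by rewrite ler_nat.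
rewrite /dual_potential -/d; move: M4; set M : R := N%:R => M4.
have Mf : 2 * M * (Phi N + dotv (p N) (p N) / 2)
   <= 2 * M * dotv (p N) (dual_mid lam s p N).
  by apply: ler_wpM2l f1; lra.
have Mg : 2 * M * Psi N <= 2 * M * dotv (s N) (lam N).
  by apply: ler_wpM2l g1; lra.
have q1 := dotv_ge0 (lam N - M *: (p N + s N)).
(* The coefficient [M (M - 2)] of [|d|^2] must cover the [2 M] of the claim, which takes
   [M >= 4]. *)
have q2 : 0 <= M * (M - 4) * dotv d d.
  by apply: mulr_ge0; [nra | exact: dotv_ge0].
have q3 : 0 <= M * dotv (p N) (p N).
  by apply: mulr_ge0; [lra | exact: dotv_ge0].
suff H : dotv (lam N) (lam N)
    + M ^+ 2 * dotv (p N + s N) (p N + s N) =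
    dotv (lam N - M *: (p N + s N)) (lam N - M *: (p N + s N))
    + 2 * M * dotv (p N) (dual_mid lam s p N)
    - 2 * M * dotv (p N) d
    + 2 * M * dotv (s N) (lam N) by lra.
rewrite /d /dual_mid.
have := dual_runE run (k := N.-1).
rewrite prednK; last by case/andP: N0.
move=> /(_ (leqnn _)) E.
have E' : lam N.-1 = lam N + p N + s N by rewrite E addrAC !subrK.
by rewrite E'; dotv_ring.
Qed.

Lemma dual_run_rate {R : realType} {r N} {lam s p : nat -> 'cV[R]_r}
    {Phi Psi : nat -> R} (run : dual_run N lam s p Phi Psi) :
    (4 <= N)%N ->
  4 * N%:R * (Phi N + Psi N - dotv (p N) (s N - s N.-1)
              + dotv (s N - s N.-1) (s N - s N.-1) / 2)
  <= dotv (lam 0) (lam 0) + dotv (s 0) (s 0).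
Proof.
move=> N4; apply: le_trans (dual_potential_ge run N4) _.
apply: le_trans (dual_potential4_le run N4).
suff potential_le k : (4 <= k)%N -> (k <= N)%N ->
    dual_potential lam s p Phi Psi k <= dual_potential lam s p Phi Psi 4.
  exact: potential_le.
elim: k => // k IH; rewrite leq_eqVlt => /predU1P[<- //|k4] kN.
apply: le_trans (IH k4 (ltnW kN)).
by apply: dual_potential_decr run _ _; apply/andP.
Qed.

(** * From ADMM to the dual iteration *)

(** The descent lemma for [phi]: the inequality for [f] holds with [nu] instead of [l], and its
    strong convexity absorbs the error [<l - nu, A (y - x)>] by completing a square. *)
Lemma dual_objective_lower {R : realType} {n m r : nat}
    {f : 'cV[R]_n -> \bar R} {g : 'cV[R]_m -> \bar R}
    {A : 'M[R]_(r, n)} {B : 'M[R]_(r, m)} {b : 'cV[R]_r}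
    {c t : R} {nu l : 'cV[R]_r} {x : 'cV[R]_n} {z : 'cV[R]_m} {fx gz : R} :
    (forall y, f y != -oo%E) -> (forall w, g w != -oo%E) ->
    0 < t -> t <= c ->
    (forall y fy, f y = fy%:E -> fx - dotv nu (A *m (y - x))
       + c / 2 * dotv (A *m (y - x)) (A *m (y - x)) <= fy) ->
    (forall w gw, g w = gw%:E -> gz - dotv l (B *m (w - z)) <= gw) ->
  ((fx + gz + dotv l (A *m x + B *m z - b)
    - dotv (l - nu) (l - nu) / (2 * t))%:E <= dual_objective f g A B b l)%E.
Proof.
move=> fNy gNy t0 tc f_sub g_sub.
apply: le_ereal_inf_tmp => _ [[y w] _ <-]; rewrite /lagrangian /=.
have := fNy y; have := gNy w.
case fyE : (f y) => [fy| |] //; case gwE : (g w) => [gw| |] // _ _;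
  try exact: leey.
rewrite -!EFinD lee_fin.
have {f_sub}f_sub := f_sub _ _ fyE; have {g_sub}g_sub := g_sub _ _ gwE.
rewrite !mulmxBr in f_sub g_sub.
move: f_sub g_sub; move: (A *m x) (A *m y) (B *m z) (B *m w) => ax ay bz bw.
move=> f_sub g_sub.
have D0 := dotv_ge0 (ay - ax).
have sq := dotv_ge0 (t *: (ay - ax) + (l - nu)).
have sqE : dotv (t *: (ay - ax) + (l - nu)) (t *: (ay - ax) + (l - nu))
  = t ^+ 2 * dotv (ay - ax) (ay - ax) + 2 * t * dotv (l - nu) (ay - ax)
    + dotv (l - nu) (l - nu) by dotv_ring.
have sq' : 0 <= t / 2 * dotv (ay - ax) (ay - ax) + dotv (l - nu) (ay - ax)
    + dotv (l - nu) (l - nu) / (2 * t).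
  have -> : t / 2 * dotv (ay - ax) (ay - ax) + dotv (l - nu) (ay - ax)
    + dotv (l - nu) (l - nu) / (2 * t) =
    dotv (t *: (ay - ax) + (l - nu)) (t *: (ay - ax) + (l - nu)) / (2 * t).
    by rewrite sqE; field; rewrite gt_eqF.
  by rewrite divr_ge0 // mulr_ge0 // ltW.
have lin : dotv l (ay + bw - b) = dotv l (ax + bz - b) + dotv l (bw - bz)
   + dotv (l - nu) (ay - ax) + dotv nu (ay - ax) by dotv_ring.
have : t / 2 * dotv (ay - ax) (ay - ax) <= c / 2 * dotv (ay - ax) (ay - ax).
  by apply: ler_wpM2r => //; rewrite ler_pM2r // invr_gt0.
lra.
Qed.

(** The values are, up to rewriting, [- (F k - Fs + <nu k, a k>)/t] and
    [- (G k - Gs + <l k, b' k>)/t], rescaled conjugates. Conjugation swaps the indices: a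
    subgradient of [f] at [x i] tested at [x j] bounds [phi] from the point [j] to the point [i]. *)
Lemma dual_run_of_admm {R : realType} {r : nat} {N : nat} {t c : R}
    {l a b' : nat -> 'cV[R]_r} {ls : 'cV[R]_r} {F G : nat -> R} {Fs Gs : R}
    (nu := fun k => l k.-1 + t *: (a k + b' k.-1)) :
    0 < t -> t <= c ->
    (forall k, (0 < k <= N)%N -> l k = l k.-1 + t *: (a k + b' k)) ->
    (forall i j, (0 < i <= N)%N -> (0 < j <= N)%N ->
       F i - dotv (nu i) (a j - a i) + c / 2 * dotv (a j - a i) (a j - a i)
       <= F j) ->
    (forall i, (0 < i <= N)%N ->
       Fs - dotv ls (a i) + c / 2 * dotv (a i) (a i) <= F i) ->
    (forall i j, (0 < i <= N)%N -> (0 < j <= N)%N ->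
       G i - dotv (l i) (b' j - b' i) <= G j) ->
    (forall i, (0 < i <= N)%N -> Gs - dotv ls (b' i) <= G i) ->
    let lam k := t^-1 *: (l k - ls) in
  dual_run N lam (fun k => - b' k) (fun k => - a k)
    (fun k => dotv (t^-1 *: (nu k - ls)) (- a k)
              - t^-1 * (F k - Fs + dotv ls (a k)))
    (fun k => dotv (lam k) (- b' k) - t^-1 * (G k - Gs + dotv ls (b' k))).
Proof.
move=> t0 tc lE Fcvx Fopt Gcvx Gopt lam.
have tV0 : 0 < t^-1 by rewrite invr_gt0.
have tVt : t^-1 * t = 1 by rewrite mulVf // gt_eqF.
(* Here [t <= c] turns the modulus of [f] into 1-smoothness of [phi]. *)
have half (u : 'cV[R]_r) : dotv u u / 2 <= t^-1 * (c / 2 * dotv u u).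
  have -> : t^-1 * (c / 2 * dotv u u) = t^-1 * c * (dotv u u / 2) by ring.
  rewrite ler_peMl ?divr_ge0 ?dotv_ge0 //.
  by rewrite -tVt ler_pM2l.
have midE k : dual_mid lam (fun k => - b' k) (fun k => - a k) k
    = t^-1 *: (nu k - ls).
  apply/matrixP => i j; rewrite /dual_mid /lam /nu !mxE.
  by field; rewrite gt_eqF.
split.
- move=> k kN; rewrite /lam (lE k.+1) //=.
  apply/matrixP => i j; rewrite !mxE.
  by field; rewrite gt_eqF.
- move=> i j iN jN; rewrite !midE.
  have H := Fcvx _ _ iN jN.
  have H' : t^-1 * (F i - dotv (nu i) (a j - a i)
      + c / 2 * dotv (a j - a i) (a j - a i)) <= t^-1 * F j by rewrite ler_pM2l.
  have Hh := half (a j - a i).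
  have -> : - a i - - a j = a j - a i by rewrite opprK addrC.
  have E : dotv (t^-1 *: (nu j - ls)) (- a j) - t^-1 * dotv ls (a j)
     + dotv (- a j) (t^-1 *: (nu i - ls) - t^-1 *: (nu j - ls)) =
     dotv (t^-1 *: (nu i - ls)) (- a i) - t^-1 * dotv ls (a i)
     - t^-1 * dotv (nu i) (a j - a i).
    by dotv_ring.
  lra.
- move=> k kN; rewrite midE.
  have H := Fopt _ kN.
  have H' : t^-1 * (Fs - dotv ls (a k) + c / 2 * dotv (a k) (a k))
    <= t^-1 * F k by rewrite ler_pM2l.
  have Hh := half (a k).
  have -> : dotv (- a k) (- a k) = dotv (a k) (a k) by dotv_ring.
  have -> : dotv (- a k) (t^-1 *: (nu k - ls))
      = dotv (t^-1 *: (nu k - ls)) (- a k).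
    by dotv_ring.
  lra.
- move=> i j iN jN.
  have H := Gcvx _ _ iN jN.
  have H' : t^-1 * (G i - dotv (l i) (b' j - b' i)) <= t^-1 * G j
    by rewrite ler_pM2l.
  have E : dotv (lam j) (- b' j) - t^-1 * dotv ls (b' j)
     + dotv (- b' j) (lam i - lam j) =
     dotv (lam i) (- b' i) - t^-1 * dotv ls (b' i)
     - t^-1 * dotv (l i) (b' j - b' i).
    by rewrite /lam; dotv_ring.
  lra.
- move=> k kN.
  have H := Gopt _ kN.
  have H' : t^-1 * (Gs - dotv ls (b' k)) <= t^-1 * G k by rewrite ler_pM2l.
  have -> : dotv (- b' k) (lam k) = dotv (lam k) (- b' k) by dotv_ring.
  lra.
Qed.

(** * The rate for the ADMM iterates *)

Theorem theorem3 (R : realType) (n m r : nat)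
    (f : 'cV[R]_n -> \bar R) (g : 'cV[R]_m -> \bar R)
    (A : 'M[R]_(r, n)) (B : 'M[R]_(r, m)) (b : 'cV[R]_r)
    (hA : A != 0) (hB : B != 0)
    (c1 : R) (hc1 : 0 < c1) (hf : Fstrong A c1 f) (hg : F0 g)
    (xs : 'cV[R]_n) (zs : 'cV[R]_m) (ls : 'cV[R]_r)
    (hopt : optimal_solution f g A B b xs zs)
    (hls : dual_maximizer f g A B b ls)
    (hsd : strong_duality f g A B b)
    (t : R) (ht : 0 < t) (N : nat)
    (l0 : 'cV[R]_r) (z0 : 'cV[R]_m)
    (x : nat -> 'cV[R]_n) (z : nat -> 'cV[R]_m) (l : nat -> 'cV[R]_r)
    (hadmm : admm f g A B b t N l0 z0 x z l)
    (htc : t <= c1) (hN : (4 <= N)%N) :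
  (dual_objective f g A B b ls - dual_objective f g A B b (l N)
   <= ((enorm (l0 - ls) ^+ 2 + t ^+ 2 * seminorm_mx B (z0 - zs) ^+ 2)
       / (4 * N%:R * t))%:E)%E.
Proof.
have [_ f_proper f_cvx] := hf; have [_ g_proper g_cvx] := hg.
have dual_ls := dual_optimum hopt hls hsd.
have feas : A *m xs + B *m zs = b by have [] := hopt.
have dual_le y w := dual_objective_le f g A B b ls y w.
rewrite dual_ls in dual_le *.
(* [f xs + g zs] equals the dual value, hence lies below a finite value of the Lagrangian; this
   excludes [+oo]. *)
have [fs fsE] : exists fs, f xs = fs%:E.
  have [y [fy fyE]] := proper_fin f_proper.
  have [w [gw gwE]] := proper_fin g_proper.
  have := dual_le y w; rewrite fyE gwE.
  have := f_proper.1 xs; have := g_proper.1 zs.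
  by case: (f xs) => [v| |]; case: (g zs) => [v'| |] //; exists v.
have [gs gsE] : exists gs, g zs = gs%:E.
  have [w [gw gwE]] := proper_fin g_proper.
  have := dual_le xs w; rewrite fsE gwE; have := g_proper.1 zs.
  by case: (g zs) => [v'| |] //; exists v'.
(* Freezing the other block at its optimal value splits the minimality of the Lagrangian. *)
have xs_min y :
    (f xs + (dotv ls (A *m xs))%:E <= f y + (dotv ls (A *m y))%:E)%E.
  have := dual_le y zs; rewrite fsE gsE -feas.
  case: (f y) => [fy| |] //=; rewrite -?EFinD ?lee_fin ?leey //.
  have -> : dotv ls (A *m y + B *m zs - (A *m xs + B *m zs))
    = dotv ls (A *m y) - dotv ls (A *m xs).
    by move: (A *m y) (A *m xs) (B *m zs) => u v w; dotv_ring.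
  lra.
have zs_min y :
    (g zs + (dotv ls (B *m zs))%:E <= g y + (dotv ls (B *m y))%:E)%E.
  have := dual_le xs y; rewrite fsE gsE -feas.
  case: (g y) => [gy| |] //=; rewrite -?EFinD ?lee_fin ?leey //.
  have -> : dotv ls (A *m xs + B *m y - (A *m xs + B *m zs))
    = dotv ls (B *m y) - dotv ls (B *m zs).
    by move: (B *m y) (A *m xs) (B *m zs) => u v w; dotv_ring.
  lra.
have xs_sub := argmin_strong_subgradient ls 0 f_cvx xs_min.
have zs_sub := argmin_strong_subgradient ls 0 (strongly_convex0 B g_cvx) zs_min.
have [l0E z0E steps] := hadmm.
have fE k : (0 < k <= N)%N -> f (x k) = (fine (f (x k)))%:E.
  by case/steps => x_min _ _; exact: argmin_fin_num f_proper x_min.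
have gE k : (0 < k <= N)%N -> g (z k) = (fine (g (z k)))%:E.
  by case/steps => _ z_min _; exact: argmin_fin_num g_proper z_min.
(* Centring at a feasible pair removes [b] from the residual. *)
pose a k := A *m (x k - xs); pose b' k := B *m (z k - zs).
pose nu k := l k.-1 + t *: (a k + b' k.-1).
have resE u v : A *m u + B *m v - b = A *m (u - xs) + B *m (v - zs).
  by rewrite -feas !mulmxBr opprD addrACA.
have f_sub k : (0 < k <= N)%N -> forall y fy, f y = fy%:E ->
    fine (f (x k)) - dotv (nu k) (A *m (y - x k))
     + c1 / 2 * dotv (A *m (y - x k)) (A *m (y - x k)) <= fy.
  move=> kN y fy fyE; have [x_min _ _] := steps k kN.
  have := admm_x_subgradient f_cvx x_min y _ _ (fE k kN) fyE.
  by rewrite resE.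
have g_sub k : (0 < k <= N)%N -> forall w gw, g w = gw%:E ->
    fine (g (z k)) - dotv (l k) (B *m (w - z k)) <= gw.
  move=> kN w gw gwE; have [_ z_min lE] := steps k kN.
  have := admm_z_subgradient g_cvx z_min w _ _ (gE k kN) gwE.
  by rewrite -lE.
have diffA y y' : A *m (y - y') = A *m (y - xs) - A *m (y' - xs).
  by rewrite -mulmxBr opprB addrA subrK.
have diffB y y' : B *m (y - y') = B *m (y - zs) - B *m (y' - zs).
  by rewrite -mulmxBr opprB addrA subrK.
have l_step k : (0 < k <= N)%N -> l k = l k.-1 + t *: (a k + b' k).
  by move=> kN; have [_ _ ->] := steps k kN; rewrite resE.
have F_cvx i j : (0 < i <= N)%N -> (0 < j <= N)%N ->
    fine (f (x i)) - dotv (nu i) (a j - a i)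
      + c1 / 2 * dotv (a j - a i) (a j - a i) <= fine (f (x j)).
  by move=> iN jN; have := f_sub i iN _ _ (fE j jN); rewrite (diffA (x j)).
have F_opt i : (0 < i <= N)%N ->
    fs - dotv ls (a i) + c1 / 2 * dotv (a i) (a i) <= fine (f (x i)).
  move=> iN; apply: xs_sub fsE (fE i iN) => y.
  by rewrite mul0r addr0 mulmxBr; move: (A *m y) (A *m xs) => u v; dotv_ring.
have G_cvx i j : (0 < i <= N)%N -> (0 < j <= N)%N ->
    fine (g (z i)) - dotv (l i) (b' j - b' i) <= fine (g (z j)).
  by move=> iN jN; have := g_sub i iN _ _ (gE j jN); rewrite (diffB (z j)).
have G_opt i : (0 < i <= N)%N -> gs - dotv ls (b' i) <= fine (g (z i)).
  move=> iN.
  have := zs_sub _ _ _ _ gsE (gE i iN); rewrite !mul0r addr0; apply=> y.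
  by rewrite mul0r addr0 mulmxBr; move: (B *m y) (B *m zs) => u v; dotv_ring.
have run := dual_run_of_admm ht htc l_step F_cvx F_opt G_cvx G_opt.
have NN : (0 < N <= N)%N by rewrite leqnn andbT (ltn_trans _ hN).
have := dual_run_rate run hN.
have lower := dual_objective_lower (b := b) f_proper.1 g_proper.1 ht htc
  (f_sub N NN) (g_sub N NN).
have M0 : 0 < N%:R :> R by rewrite ltr0n; case/andP: NN.
have lNE := l_step N NN.
rewrite /seminorm_mx !enorm_sqr fsE gsE.
move: lower; rewrite resE -/(a N) -/(b' N) /=.
rewrite -l0E -z0E -/(b' 0%N).
(* [lower] rules out [-oo]; at [+oo] the gap is [-oo] and the bound is trivial. *)
case: (dual_objective f g A B b (l N)) => [v| |] //;
  last by move=> *; exact: leNye.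
rewrite lee_fin -!EFinD lee_fin => lower rate.
move: lower rate; rewrite /nu lNE.
move: (a N) (b' N) (b' N.-1) (l N.-1) => aN bN bN' lN' lower rate.
have t_neq0 : t != 0 by rewrite gt_eqF.
(* The loss [|l - nu|^2 / (2t)] in [lower] becomes [t |d|^2 / 2], which matches the [|d|^2 / 2] of
   [rate] after division by [t]. *)
have gap : dotv (lN' + t *: (aN + bN) - (lN' + t *: (aN + bN')))
    (lN' + t *: (aN + bN) - (lN' + t *: (aN + bN')))
  = t ^+ 2 * dotv (bN - bN') (bN - bN') by dotv_ring.
(* Subtracting [<p_N, d_N>] replaces [nu N] by [l N] in the pairing with [aN], so both blocks are
   evaluated at the final multiplier. *)
have cross : dotv (t^-1 *: (lN' + t *: (aN + bN') - ls)) (- aN)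
    + dotv (t^-1 *: (lN' + t *: (aN + bN) - ls)) (- bN)
    - dotv (- aN) (- bN - - bN') =
    - t^-1 * dotv (lN' + t *: (aN + bN)) (aN + bN)
    + t^-1 * dotv ls aN + t^-1 * dotv ls bN.
  by dotv_sum; field.
have start : dotv (t^-1 *: (l 0%N - ls)) (t^-1 *: (l 0%N - ls))
    + dotv (- b' 0%N) (- b' 0%N) =
    t ^- 2 * (dotv (l 0%N - ls) (l 0%N - ls)
              + t ^+ 2 * dotv (b' 0%N) (b' 0%N)).
  by rewrite mulrDr mulrA mulVf ?expf_neq0 // mul1r; dotv_sum; field.
have dE : dotv (- bN - - bN') (- bN - - bN') = dotv (bN - bN') (bN - bN').
  by dotv_ring.
rewrite gap in lower; rewrite start dE in rate.
set V := dotv (l 0%N - ls) _ + _ in rate *.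
set DD := dotv (bN - bN') _ in lower rate cross.
set M := N%:R in rate M0 *.
rewrite ler_pdivlMr; last by rewrite !mulr_gt0.
have {}rate : 4 * M * (t^-1 * (fs + gs - (fine (f (x N)) + fine (g (z N))
    + dotv (lN' + t *: (aN + bN)) (aN + bN) - t ^+ 2 * DD / (2 * t))))
    <= t ^- 2 * V.
  have -> : t ^+ 2 * DD / (2 * t) = t * DD / 2 by field.
  apply: le_trans rate; rewrite ler_pM2l ?mulr_gt0 // -subr_ge0 le_eqVlt.
  apply/orP; left; apply/eqP.
  have tt : t^-1 * (t * DD / 2) = DD / 2 by field.
  lra.
have rate' : t ^+ 2 * (4 * M * (t^-1 * (fs + gs - v)))
    <= t ^+ 2 * (t ^- 2 * V).
  rewrite ler_pM2l ?exprn_gt0 //; apply: le_trans rate.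
  by rewrite !ler_pM2l ?mulr_gt0 ?invr_gt0 //; lra.
have -> : (fs + gs - v) * (4 * M * t)
    = t ^+ 2 * (4 * M * (t^-1 * (fs + gs - v))).
  by field.
apply: le_trans rate' _.
by rewrite mulrA mulfV ?mul1r // expf_neq0.
Qed.
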